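(* There is no $4$-uniform Šoltés' hypergraph of order $9$.
   Context: A hypergraph $H=(V,E)$ consists of a finite vertex set $V$ and a set $E$ of distinct subsets of $V$ (hyperedges). $H$ is $k$-uniform if every hyperedge has exactly $k$ elements. The order of $H$ is $|V|$. For $u,w\in V$, the distance $d_H(u,w)$ is the least $\ell\ge 0$ such that there are vertices $u=x_0,\dots,x_\ell=w$ with $x_{i-1},x_i$ contained in a common hyperedge for each $i$ ($\infty$ if none exists); $H$ is connected if all distances are finite. $W(H)=\sum_{\{u,w\}\subseteq V,\,u\ne w} d_H(u,w)$. For $v\in V$, $H\setminus v$ has vertex set $V\setminus\{v\}$ and hyperedge set $\{e\in E: v\notin e\}$. A Šoltés' hypergraph is a connected hypergraph $H$ with $W(H\setminus v)=W(H)$ for every $v\in V$. *)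

(* Defs.v *)
From HB Require Import structures.
From mathcomp Require Import all_boot.

Set Implicit Arguments.
Unset Strict Implicit.
Unset Printing Implicit Defensive.

Record hypergraph (T : finType) := Hypergraph {
  hverts : {set T};
  hedges : {set {set T}};
  hedges_sub : [forall (e | e \in hedges), e \subset hverts] }.

(* Extended naturals: [None] is infinity. *)
Definition enat := option nat.

Definition eadd (x y : enat) : enat :=
  if x is Some m then if y is Some n then Some (m + n) else None else None.

Fact eaddA : associative eadd.
Proof. by case=> [m|] [n|] [p|] //=; rewrite addnA. Qed.

Fact eaddC : commutative eadd.
Proof. by case=> [m|] [n|] //=; rewrite addnC. Qed.

Fact eadd0 : left_id (Some 0) eadd.
Proof. by case. Qed.

HB.instance Definition _ := Monoid.isComLaw.Build enat (Some 0) eadd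
  eaddA eaddC eadd0.

Section Hypergraph.
Variables (T : finType) (H : hypergraph T).

Definition horder : nat := #|hverts H|.

Definition uniform (k : nat) : Prop := forall e, e \in hedges H -> #|e| = k.

Definition hadj : rel T :=
  [rel x y | [exists e in hedges H, (x \in e) && (y \in e)]].

Definition hwalk (u w : T) (l : nat) : bool :=
  [exists p : l.-tuple T, path hadj u p && (last u p == w)].

Fact hwalk_ex u w : connect hadj u w -> exists l, hwalk u w l.
Proof.
case/connectP=> p hp ->; exists (size p); apply/existsP.
by exists (in_tuple p); rewrite hp eqxx.
Qed.

Definition hdist (u w : T) : enat :=
  if @idP (connect hadj u w) is ReflectT c then Some (ex_minn (hwalk_ex c))
  else None.

Lemma hdist_Some u w l :
  hdist u w = Some l <-> hwalk u w l /\ (forall m, hwalk u w m -> l <= m).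
Proof.
rewrite /hdist; case: {-}_ / idP => [c|nc].
  case: ex_minnP => m hm minm; split=> [[<-] //|[hl minl]].
  by congr Some; apply/eqP; rewrite eqn_leq minm // minl.
split=> // -[/existsP[p /andP[hp /eqP hl]] _].
by case: nc; apply/connectP; exists (val p).
Qed.

Lemma hdist_None u w : hdist u w = None <-> (forall l, ~~ hwalk u w l).
Proof.
rewrite /hdist; case: {-}_ / idP => [c|nc].
  by split=> // hn; have [l hl] := hwalk_ex c; move: (hn l); rewrite hl.
split=> // _ l; apply/negP=> /existsP[p /andP[hp /eqP hl]].
by case: nc; apply/connectP; exists (val p).
Qed.

Definition hconnected : Prop :=
  forall u w, u \in hverts H -> w \in hverts H -> hdist u w <> None.

(* The comparison of ranks selects one ordered representative (u, w) of each
   unordered pair of distinct vertices; [hdist] is symmetric ([hdistC]). *)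
Definition wiener : enat :=
  \big[eadd/Some 0]_(p : T * T | [&& p.1 \in hverts H, p.2 \in hverts H
                                  & enum_rank p.1 < enum_rank p.2])
    hdist p.1 p.2.

Fact hdel_sub (v : T) :
  [forall (e | e \in [set e in hedges H | v \notin e]),
     e \subset hverts H :\ v].
Proof.
apply/forall_inP=> e; rewrite inE => /andP[eH ve].
by rewrite subsetD1 ve (forall_inP (hedges_sub H)).
Qed.

Definition hdel (v : T) : hypergraph T := Hypergraph (hdel_sub v).

End Hypergraph.

Lemma hwalkC (T : finType) (H : hypergraph T) u w l :
  hwalk H u w l = hwalk H w u l.
Proof.
suff imp x y : hwalk H x y l -> hwalk H y x l by apply/idP/idP; apply: imp.
case/existsP=> p /andP[hp /eqP <-]; apply/existsP.
have sz : size (rev (belast x p)) == l by rewrite size_rev size_belast size_tuple.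
exists (Tuple sz) => /=; rewrite rev_path; apply/andP; split.
  apply: sub_path hp => a b /existsP[e /and3P[eH ae be]].
  by apply/existsP; exists e; rewrite eH ae be.
by case: (val p) => [|a q] //=; rewrite rev_cons last_rcons.
Qed.

Lemma hdistC (T : finType) (H : hypergraph T) u w : hdist H u w = hdist H w u.
Proof.
case E: (hdist H w u) => [l|].
  have [hl ml] := (hdist_Some H w u l).1 E.
  apply/hdist_Some; split=> [|m]; rewrite hwalkC //; exact: ml.
by apply/hdist_None=> l; rewrite hwalkC; apply/(hdist_None H w u).1.
Qed.

Definition soltes (T : finType) (H : hypergraph T) : Prop :=
  hconnected H /\ forall v, v \in hverts H -> wiener (hdel H v) = wiener H.

(* Main.v *)
Require Import Defs.
From mathcomp Require Import all_boot zify.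

Set Implicit Arguments.
Unset Strict Implicit.
Unset Printing Implicit Defensive.

(* All counts are over ordered pairs of distinct vertices.  Let S count the
   non-adjacent pairs of H, let S_v and B_v count the pairs of H \ v at distance
   at least 2 and at least 3, and let D be the sum over all pairs of
   max(0, 2 - own), where own is the number of other vertices lying in every
   edge through the pair.  A connected 4-uniform hypergraph of order 8 has
   diameter at most 3, so W(H \ v) = W(H) reads S_v + B_v = 16 + t with
   t = 2 W(H) - 72 >= S.  An adjacent pair has own <= 2, hence
   sum_v S_v = 144 + 5 S - D, and summing over v gives sum_v B_v >= 4 t + D.

   Take v with B_v maximal, so that 9 B_v >= 4 t + D.  If B_v = 0, then H is a
   Steiner system S(2,4,9), which does not exist.  Otherwise two vertices x, y
   are at distance 3 in H \ v; their closed neighbourhoods there are disjoint,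
   hence are single edges A and B that partition V \ v, and x, y lie in no
   other edge avoiding v.  After labelling A = 0123, B = 4567, v = 8, x = 0,
   y = 4, a branch-and-bound search over the remaining edges shows that the
   inequality fails: D increases and S, S_v, B_v decrease with the edge set. *)

(** * Distances and the Wiener index *)

Definition pairsum (T : finType) (A : {set T}) (f : T -> T -> nat) : nat :=
  \sum_(x in A) \sum_(y in A | y != x) f x y.

Lemma eq_pairsum (T : finType) (A : {set T}) (f g : T -> T -> nat) :
  (forall x y, x \in A -> y \in A -> y != x -> f x y = g x y) ->
  pairsum A f = pairsum A g.
Proof.
by move=> fg; apply: eq_bigr => x xA; apply: eq_bigr => y /andP[yA yx]; apply: fg.
Qed.

Lemma leq_pairsum (T : finType) (A : {set T}) (f g : T -> T -> nat) :
  (forall x y, x \in A -> y \in A -> y != x -> f x y <= g x y) ->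
  pairsum A f <= pairsum A g.
Proof.
by move=> fg; apply: leq_sum => x xA; apply: leq_sum => y /andP[yA yx]; apply: fg.
Qed.

Lemma pairsumD (T : finType) (A : {set T}) (f g : T -> T -> nat) :
  pairsum A (fun x y => f x y + g x y) = pairsum A f + pairsum A g.
Proof. by rewrite /pairsum -big_split; apply: eq_bigr => x _; rewrite big_split. Qed.

Lemma pairsum_const (T : finType) (A : {set T}) c :
  pairsum A (fun _ _ => c) = #|A| * #|A|.-1 * c.
Proof.
rewrite /pairsum (eq_bigr (fun _ => #|A|.-1 * c)) => [|x xA].
  by rewrite sum_nat_const mulnA.
rewrite (eq_bigl (mem (A :\ x))) => [|y]; last by rewrite !inE andbC.
by rewrite sum_nat_const [#|A|](cardsD1 x) xA.
Qed.

Lemma pairsum_eq0 (T : finType) (A : {set T}) (f : T -> T -> nat) x y :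
  pairsum A f = 0 -> x \in A -> y \in A -> y != x -> f x y = 0.
Proof.
move=> /eqP; rewrite sum_nat_eq0 => /forall_inP f0 xA yA yx.
move: (f0 _ xA); rewrite sum_nat_eq0 => /forall_inP/(_ y).
by rewrite yA yx => /(_ isT)/eqP.
Qed.

(** Swapping the coordinates exchanges the two halves cut out by the comparison of ranks. *)
Lemma pairsum_half (T : finType) (A : {set T}) (f : T -> T -> nat) :
  (forall x y, f x y = f y x) ->
  2 * \sum_(p : T * T | [&& p.1 \in A, p.2 \in A & enum_rank p.1 < enum_rank p.2])
        f p.1 p.2 = pairsum A f.
Proof.
move=> fC; rewrite /pairsum pair_big_dep /=.
rewrite [RHS](bigID (fun p : T * T => enum_rank p.1 < enum_rank p.2)) /= mul2n -addnn.
congr (_ + _).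
  apply: eq_bigl => -[x y] /=; case: (x \in A) (y \in A) => [] [] //=.
  by case: eqVneq => [->|]; rewrite ?ltnn.
pose sw (p : T * T) := (p.2, p.1).
rewrite (reindex_inj (h := sw)) /=; last by move=> [? ?] [? ?] [-> ->].
apply: eq_big => -[x y] /=; last by rewrite fC.
case: (x \in A) (y \in A) => [] [] //=.
by rewrite -(inj_eq enum_rank_inj) -val_eqE ltn_neqAle leqNgt.
Qed.

Lemma big_eadd_Some (I : finType) (P : pred I) (F : I -> enat) (g : I -> nat) :
  (forall i, P i -> F i = Some (g i)) ->
  \big[eadd/Some 0]_(i | P i) F i = Some (\sum_(i | P i) g i).
Proof.
by move=> FE; elim/big_rec2: _ => // i y1 y2 Pi ->; rewrite FE.
Qed.

Lemma big_eadd_None (I : finType) (P : pred I) (F : I -> enat) i :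
  P i -> F i = None -> \big[eadd/Some 0]_(i | P i) F i = None.
Proof. by move=> Pi Fi; rewrite (bigD1 i) //= Fi. Qed.

Section Distances.
Variables (T : finType) (H : hypergraph T).

Lemma hadjP x y :
  reflect (exists e, [/\ e \in hedges H, x \in e & y \in e]) (hadj H x y).
Proof.
apply: (iffP existsP) => -[e]; first by case/and3P; exists e.
by case=> eH xe ye; exists e; rewrite eH xe.
Qed.

Lemma hadj_vert x y : hadj H x y -> y \in hverts H.
Proof.
by case/hadjP=> e [eH _]; apply: (subsetP (forall_inP (hedges_sub H) _ eH)).
Qed.

Lemma hwalkP u w l :
  reflect (exists p, [/\ size p = l, path (hadj H) u p & last u p = w])
          (hwalk H u w l).
Proof.
apply: (iffP existsP) => [[p /andP[pp /eqP pw]]|[p [<- pp pw]]].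
  by exists p; rewrite size_tuple.
by exists (in_tuple p); rewrite pp pw /=.
Qed.

Definition nonadj x y : bool := ~~ hadj H x y.

(** For distinct vertices: distance at least 3, infinity included. *)
Definition far x y : bool :=
  ~~ (hadj H x y || [exists z, hadj H x z && hadj H z y]).

(** A walk of length 1 excludes both [nonadj] and [far], one of length 2 excludes [far]; from length
    3 on, the bound holds because both indicators are at most 1. *)
Lemma hdist_ge x y l :
  hdist H x y = Some l -> x != y -> 1 + nonadj x y + far x y <= l.
Proof.
case/hdist_Some => /hwalkP[p [<- pp <-]] _; rewrite /far /nonadj.
case: p pp => [|z [|z' [|? ?]]] /=; first by rewrite eqxx.
- by rewrite andbT => ->.
- case/and3P=> a b _ _; rewrite (_ : [exists _, _]); last first.
    by apply/existsP; exists z; rewrite a.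
  by rewrite orbT; case: hadj.
- by move=> _ _; apply: (@leq_trans (1 + 1 + 1)); rewrite ?leq_add ?leq_b1.
Qed.

Lemma hdist_le x y l :
  hdist H x y = Some l -> hwalk H x y 3 -> l <= 1 + nonadj x y + far x y.
Proof.
case/hdist_Some => _ minl w3; rewrite /far /nonadj.
case: (boolP (hadj H x y)) => [a|_] /=.
  by apply: minl; apply/hwalkP; exists [:: y]; rewrite /= a.
case: existsP => [[z /andP[a b]]|_] /=; last exact: minl.
by apply: minl; apply/hwalkP; exists [:: z; y]; rewrite /= a b.
Qed.

Lemma wiener_pairsum : hconnected H ->
  exists w, wiener H = Some w /\
    2 * w = pairsum (hverts H) (fun x y => odflt 0 (hdist H x y)).
Proof.
move=> con; eexists; split; last first.
  by rewrite -pairsum_half // => x y; rewrite hdistC.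
apply: big_eadd_Some => -[x y] /= /and3P[xV yV _].
by case: hdist (con x y xV yV).
Qed.

Lemma wiener_connected w : wiener H = Some w -> hconnected H.
Proof.
move=> wE x y xV yV dN.
have lt a b : a \in hverts H -> b \in hverts H -> hdist H a b = None ->
    ~~ (enum_rank a < enum_rank b).
  move=> aV bV dab; apply/negP => ab.
  have wN : wiener H = None.
    by apply: (@big_eadd_None _ _ _ (a, b)); rewrite //= aV bV ab.
  by rewrite wN in wE.
have := lt x y xV yV dN; have := lt y x yV xV; rewrite hdistC => /(_ dN).
rewrite -!leqNgt => le1 le2.
(* Neither order of the pair enters the sum, so the vertices coincide and the empty walk joins
   them. *)
have xy : x = y by apply/enum_rank_inj/val_inj/eqP; rewrite eqn_leq le1 le2.
have /hdist_None/(_ 0)/negP[] := dN.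
by apply/hwalkP; exists [::]; rewrite xy.
Qed.

Lemma hconnected_edge x y :
  hconnected H -> x \in hverts H -> y \in hverts H -> x != y ->
  exists2 e, e \in hedges H & x \in e.
Proof.
move=> con xV yV xy; case dE: (hdist H x y) (con x y xV yV) => [l|] // _.
have [/hwalkP[p [_ pp pl]] _] := (hdist_Some H x y l).1 dE.
case: p pp pl => [|z p] /=; first by move=> _ E; rewrite E eqxx in xy.
by case/andP=> /hadjP[e [eH xe _]] _ _; exists e.
Qed.

Lemma path_exit (A : {set T}) x p :
  path (hadj H) x p -> x \in A -> last x p \notin A ->
  exists a b, [/\ a \in A, b \notin A & hadj H a b].
Proof.
elim: p x => [|y p IHp] x /=; first by move=> _ ->.
case/andP=> xy pp xA; case: (boolP (y \in A)) => [yA|yA _]; first exact: IHp.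
by exists x, y.
Qed.

Lemma hconnected_exit (A : {set T}) x y :
  hconnected H -> x \in hverts H -> y \in hverts H -> x \in A -> y \notin A ->
  exists a b, [/\ a \in A, b \notin A & hadj H a b].
Proof.
move=> con xV yV xA yA; case dE: (hdist H x y) (con x y xV yV) => [l|] // _.
have [/hwalkP[p [_ pp pl]] _] := (hdist_Some H x y l).1 dE.
by apply: (path_exit pp) => //; rewrite pl.
Qed.

End Distances.

(** * Connected 4-uniform hypergraphs on eight vertices *)

Section EightVertices.
Variables (T : finType) (H : hypergraph T).
Hypotheses (order8 : horder H = 8) (uniform4 : uniform H 4).
Hypothesis con : hconnected H.

Lemma disjoint_edges_cover A B : A \in hedges H -> B \in hedges H ->
  [disjoint A & B] -> A :|: B = hverts H.
Proof.
move=> AH BH dAB; apply/eqP; rewrite eqEcard subUset !(forall_inP (hedges_sub H)) //=.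
have := cardsUI A B; rewrite (uniform4 AH) (uniform4 BH).
move: dAB; rewrite -setI_eq0 => /eqP ->; rewrite cards0 addn0 => ->.
by rewrite -/(horder H) order8.
Qed.

(** Take edges A at x and B at y. If they meet, walk through a common vertex, with a first step from
    x to itself inside A to reach length 3. Otherwise they cover all vertices, and connectivity
    gives an edge from A to B. *)
Lemma hwalk3 x y : x \in hverts H -> y \in hverts H -> x != y -> hwalk H x y 3.
Proof.
move=> xV yV xy; have [A AH xA] := hconnected_edge con xV yV xy.
have yx : y != x by rewrite eq_sym.
have [B BH yB] := hconnected_edge con yV xV yx.
have adj e a b : e \in hedges H -> a \in e -> b \in e -> hadj H a b.
  by move=> eH ae be; apply/hadjP; exists e.
case: (boolP [disjoint A & B]) => [dAB|]; last first.
  rewrite -setI_eq0 => /set0Pn[z]; rewrite inE => /andP[zA zB].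
  by apply/hwalkP; exists [:: x; z; y]; rewrite /= (adj A) ?(adj A x z) ?(adj B).
have yA : y \notin A by rewrite (disjointFl dAB).
have [a [b [aA bA ab]]] := hconnected_exit con xV yV xA yA.
have bB : b \in B.
  by have := hadj_vert ab; rewrite -(disjoint_edges_cover AH BH dAB) inE (negPf bA).
by apply/hwalkP; exists [:: a; b; y]; rewrite /= ab (adj A) ?(adj B).
Qed.

(** No edge at x meets an edge at y, since a common vertex would be a common neighbour. Disjoint
    edges are complementary, so the edges at x and at y are unique. An edge leaving A is then
    neither A nor B, hence avoids x and y. *)
Lemma far_edges x y : x \in hverts H -> y \in hverts H -> x != y -> far H x y ->
  exists A B, [/\ A \in hedges H, B \in hedges H, x \in A, y \in B &
    [disjoint A & B]] /\ [/\ forall e, e \in hedges H -> x \in e -> e = A,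
    forall e, e \in hedges H -> y \in e -> e = B &
    exists2 e, e \in hedges H & (x \notin e) && (y \notin e)].
Proof.
move=> xV yV xy; rewrite /far negb_or => /andP[_ /existsPn nc].
have yx : y != x by rewrite eq_sym.
have [A AH xA] := hconnected_edge con xV yV xy.
have [B BH yB] := hconnected_edge con yV xV yx.
have dis e f : e \in hedges H -> f \in hedges H -> x \in e -> y \in f ->
    [disjoint e & f].
  move=> eH fH xe yf; rewrite -setI_eq0; apply/set0Pn => -[z].
  rewrite inE => /andP[ze zf]; case/negP: (nc z); apply/andP; split.
    by apply/hadjP; exists e.
  by apply/hadjP; exists f.
have compl e f : e \in hedges H -> f \in hedges H -> [disjoint e & f] ->
    e = hverts H :\: f.
  move=> eH fH ef; rewrite -(disjoint_edges_cover eH fH ef) setDUl setDv setU0.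
  by apply/esym/setDidPl.
have uA e : e \in hedges H -> x \in e -> e = A.
  by move=> eH xe; transitivity (hverts H :\: B); [|apply: esym]; apply: compl; rewrite ?dis.
have uB e : e \in hedges H -> y \in e -> e = B.
  move=> eH ye; transitivity (hverts H :\: A); [|apply: esym];
    by apply: compl; rewrite // disjoint_sym dis.
exists A, B; split; split=> //; first exact: dis.
have yA : y \notin A by rewrite (disjointFl (dis _ _ AH BH xA yB)).
have [a [b [aA bA /hadjP[e [eH ae be]]]]] := hconnected_exit con xV yV xA yA.
exists e => //; apply/andP; split; apply/negP.
  by move=> /(uA e eH) eA; rewrite -eA be in bA.
move=> /(uB e eH) eB; move: ae; rewrite eB.
by rewrite (disjointFr (dis _ _ AH BH xA yB) aA).
Qed.

Lemma wiener8 : exists w, wiener H = Some w /\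
  2 * w = 56 + (pairsum (hverts H) (nonadj H) + pairsum (hverts H) (far H)).
Proof.
have [w [wE ww]] := wiener_pairsum con; exists w; split=> //; rewrite ww.
have -> : 56 = pairsum (hverts H) (fun _ _ => 1).
  by rewrite pairsum_const -/(horder H) order8.
rewrite addnA -!pairsumD.
apply: eq_pairsum => x y xV yV yx; have xy : x != y by rewrite eq_sym.
case dE: (hdist H x y) (con xV yV) => [l|] // _ /=.
by apply/eqP; rewrite eqn_leq hdist_ge // hdist_le // hwalk3.
Qed.

End EightVertices.

(** * Counting over vertex deletions *)

Section NineVertices.
Variables (T : finType) (H : hypergraph T).
Hypotheses (order9 : horder H = 9) (uniform4 : uniform H 4).

Lemma hadj_hdelP v x y :
  reflect (exists e, [/\ e \in hedges H, v \notin e, x \in e & y \in e])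
          (hadj (hdel H v) x y).
Proof.
apply: (iffP (hadjP _ _ _)) => [[e []]|[e [eH ve xe ye]]].
  by rewrite inE => /andP[eH ve] xe ye; exists e.
by exists e; rewrite inE eH.
Qed.

Lemma horder_hdel v : v \in hverts H -> horder (hdel H v) = 8.
Proof. by move=> vV; move: order9; rewrite /horder (cardsD1 v) vV => -[]. Qed.

Lemma uniform_hdel v : uniform (hdel H v) 4.
Proof. by move=> e; rewrite inE => /andP[/uniform4]. Qed.

(** Non-adjacency in [hdel H v] means that every edge through x and y contains v. *)
Definition own x y : nat :=
  \sum_(v in hverts H | (v != x) && (v != y)) nonadj (hdel H v) x y.

Definition shortage x y : nat := 2 - own x y.

Lemma ownE x y :
  own x y = #|[set v in hverts H | [&& v != x, v != y & nonadj (hdel H v) x y]]|.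
Proof.
rewrite /own big_mkcondr /= -sum1dep_card [RHS]big_mkcondr /=.
by apply: eq_bigr => v _; case: (v != x) (v != y) => [] [] //=; case: nonadj.
Qed.

(** For an adjacent pair only the two further vertices of a common edge can count in [own], so the
    truncated subtraction is exact. A non-adjacent pair stays so in all 7 deletions, and 7 = 2 +
    5. *)
Lemma own_shortage x y : x \in hverts H -> y \in hverts H -> y != x ->
  own x y + shortage x y = 2 + 5 * nonadj H x y.
Proof.
move=> xV yV yx; rewrite /shortage /nonadj.
case: (boolP (hadj H x y)) => [/hadjP[e [eH xe ye]]|nxy] /=.
  rewrite muln0 addn0 subnKC // ownE.
  apply: leq_trans (_ : #|e :\ x :\ y| <= 2).
    apply/subset_leq_card/subsetP => v; rewrite !inE => /and4P[vV -> -> /=].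
    by apply: contraR => ve; apply/hadj_hdelP; exists e.
  move: (uniform4 eH); rewrite (cardsD1 x) xe (cardsD1 y) !inE ye yx.
  by rewrite !add1n => -[->].
suff -> : own x y = 7 by [].
rewrite ownE (_ : [set _ in _ | _] = hverts H :\ x :\ y).
  move: order9; rewrite /horder (cardsD1 x) xV (cardsD1 y) !inE yV yx.
  by case.
apply/setP=> v; rewrite !inE; case: (v \in _); rewrite ?andbF //= andbT andbCA.
case: (v != y); case: (v != x) => //=; apply: contra nxy.
by case/hadj_hdelP=> e [eH _ xe ye]; apply/hadjP; exists e.
Qed.

Lemma sum_nonadj_hdel :
  \sum_(v in hverts H) pairsum (hverts (hdel H v)) (nonadj (hdel H v))
  = pairsum (hverts H) own.
Proof.
rewrite /pairsum (exchange_big_dep (mem (hverts H))) /=; last first.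
  by move=> v x _; rewrite inE => /andP[].
apply: eq_bigr => x xV.
rewrite (exchange_big_dep [pred y | (y \in hverts H) && (y != x)]) /=; last first.
  by move=> v y _; rewrite !inE => /andP[/andP[_ ->] ->].
apply: eq_bigr => y /andP[yV yx]; apply: eq_bigl => v.
by rewrite !inE xV yV yx !andbT ![_ == v]eq_sym -andbA.
Qed.

Hypothesis sol : soltes H.

Lemma soltes_hdel_connected v : v \in hverts H -> hconnected (hdel H v).
Proof.
case: sol => con eqW vV; have [w [wE _]] := wiener_pairsum con.
by apply: (@wiener_connected _ _ w); rewrite eqW.
Qed.

Definition nonadjs v := pairsum (hverts (hdel H v)) (nonadj (hdel H v)).
Definition fars v := pairsum (hverts (hdel H v)) (far (hdel H v)).

Lemma soltes_count : exists2 t, pairsum (hverts H) (nonadj H) <= t &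
  forall v, v \in hverts H -> nonadjs v + fars v = 16 + t.
Proof.
case: sol => con eqW; have [w [wE ww]] := wiener_pairsum con.
have le : 72 + pairsum (hverts H) (nonadj H) <= 2 * w.
  have -> : 72 = pairsum (hverts H) (fun _ _ => 1).
    by rewrite pairsum_const -/(horder H) order9.
  rewrite ww -pairsumD; apply: leq_pairsum => x y xV yV yx.
  have xy : x != y by rewrite eq_sym.
  case dE: (hdist H x y) (con x y xV yV) => [l|] // _.
  exact: leq_trans (leq_addr _ _) (hdist_ge dE xy).
(* The bound [le] makes this subtraction exact. For H \ v the 56 ordered pairs replace the 72,
   whence 16 = 72 - 56. *)
exists (2 * w - 72); first by lia.
move=> v vV.
have [w' [wE' ww']] := wiener8 (horder_hdel vV) (uniform_hdel (v := v))
  (soltes_hdel_connected vV).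
by move: wE'; rewrite eqW // wE => -[?]; subst w'; rewrite /nonadjs /fars; lia.
Qed.

(** Substituting S_v + B_v = 16 + t turns 4 t + D <= 9 B_v and S <= t into inequalities free of t,
    which a search can test. *)
Lemma soltes_ineq : exists v, [/\ v \in hverts H,
  4 * (nonadjs v + fars v) + pairsum (hverts H) shortage <= 9 * fars v + 64 &
  pairsum (hverts H) (nonadj H) + 16 <= nonadjs v + fars v].
Proof.
have [t St eqt] := soltes_count.
have sumt : \sum_(v in hverts H) (nonadjs v + fars v) = 9 * (16 + t).
  by rewrite (eq_bigr _ eqt) sum_nat_const -/(horder H) order9.
have sumS : pairsum (hverts H) own + pairsum (hverts H) shortage
    = 144 + 5 * pairsum (hverts H) (nonadj H).
  rewrite -pairsumD (eq_pairsum own_shortage) pairsumD pairsum_const.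
  rewrite -/(horder H) order9; congr (_ + _); rewrite /pairsum big_distrr.
  by apply: eq_bigr => x _; rewrite big_distrr.
move: sumt; rewrite big_split /= -/(nonadjs) sum_nonadj_hdel => sumt.
have [v0 v0V] : exists v0, v0 \in hverts H.
  by apply/card_gt0P; rewrite -/(horder H) order9.
have [v vV maxv] : exists2 v, v \in hverts H & forall z, z \in hverts H -> fars z <= fars v.
  by case: (arg_maxnP fars v0V) => v vV maxv; exists v.
have le : \sum_(v in hverts H) fars v <= 9 * fars v.
  by rewrite -order9 /horder -sum_nat_const; apply: leq_sum.
by exists v; rewrite vV; have := eqt v vV; split=> //; lia.
Qed.

(* Every two vertices lie in exactly one common edge, so the edges through a
   vertex split the other 8 vertices into triples. *)
Lemma no_steiner : pairsum (hverts H) (nonadj H) = 0 ->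
  pairsum (hverts H) shortage = 0 -> False.
Proof.
move=> S0 D0.
have [v vV] : exists v, v \in hverts H.
  by apply/card_gt0P; rewrite -/(horder H) order9.
have uniq1 y : y \in hverts H :\ v ->
    \sum_(e in hedges H | v \in e) (y \in e) = 1.
  rewrite !inE => /andP[yv yV].
  have := pairsum_eq0 S0 vV yV yv; rewrite /nonadj.
  case: (boolP (hadj H v y)) => // /hadjP[e [eH ve ye]] _.
  have := pairsum_eq0 D0 vV yV yv.
  rewrite /shortage => /eqP; rewrite subn_eq0 ownE.
  set O := [set _ in _ | _] => O2.
  (* No shortage: at least two vertices lie in every edge through v and y, and together with v and y
     they fill it. *)
  have cover f : f \in hedges H -> v \in f -> y \in f -> f = v |: (y |: O).
    move=> fH vf yf; apply/esym/eqP; rewrite eqEcard !subUset !sub1set vf yf /=.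
    have yO : y \notin O by rewrite !inE eqxx !andbF.
    have vO : v \notin y |: O by rewrite !inE eqxx andbF orbF eq_sym.
    rewrite (uniform4 fH) cardsU1 vO cardsU1 yO !add1n !ltnS O2 andbT.
    apply/subsetP => z; rewrite !inE => /and4P[_ _ _].
    by apply: contraR => zf; apply/hadj_hdelP; exists f.
  rewrite (bigD1 e) /= ?eH // ye big1 ?addn0 // => f /andP[/andP[fH vf] fe].
  case: (boolP (y \in f)) => // yf.
  by rewrite (cover f fH vf yf) (cover e eH ve ye) eqxx in fe.
have : \sum_(y in hverts H :\ v) \sum_(e in hedges H | v \in e) (y \in e) = 8.
  by rewrite (eq_bigr _ uniq1) sum_nat_const muln1 -(horder_hdel vV).
rewrite exchange_big /= (eq_bigr (fun _ => 3)) => [|e /andP[eH ve]].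
  by rewrite sum_nat_cond_const; lia.
move: (uniform4 eH); rewrite (cardsD1 v) ve => -[] <-.
rewrite -big_mkcondr sum1_card; apply: eq_card => y; rewrite !inE unfold_in !inE -andbA.
case: (y != v) => //=; case: (boolP (y \in e)); rewrite ?andbF // andbT.
exact: (subsetP (forall_inP (hedges_sub H) _ eH)).
Qed.

Lemma soltes_far : exists v x y, [/\ v \in hverts H,
  4 * (nonadjs v + fars v) + pairsum (hverts H) shortage <= 9 * fars v + 64,
  pairsum (hverts H) (nonadj H) + 16 <= nonadjs v + fars v &
  [/\ x \in hverts (hdel H v), y \in hverts (hdel H v), y != x & far (hdel H v) x y]].
Proof.
have [v [vV le1 le2]] := soltes_ineq; exists v.
(* With B_v = 0 the two inequalities give 4 S + D <= 0, the Steiner case. *)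
have [f0|] := eqVneq (fars v) 0; first by case: no_steiner; lia.
rewrite sum_nat_eq0 => /forall_inPn[x xV]; rewrite sum_nat_eq0.
case/forall_inPn=> y /andP[yV yx]; case fxy: (far _ x y) => // _.
by exists x, y.
Qed.

End NineVertices.

(** * The search over concrete edge sets *)

Definition ipairsum (n : nat) (f : nat -> nat -> nat) : nat :=
  sumn [seq sumn [seq f i j | j <- iota 0 n & j != i] | i <- iota 0 n].

(* A hypergraph on {0, ..., 8} is a list of membership masks of its edges. *)
Definition iadj (C : seq bitseq) (i j : nat) : bool :=
  has (fun m => nth false m i && nth false m j) C.

Definition inonadj (C : seq bitseq) (i j : nat) : bool := ~~ iadj C i j.

Definition ifar (C : seq bitseq) (i j : nat) : bool :=
  ~~ (iadj C i j || has (fun k => iadj C i k && iadj C k j) (iota 0 9)).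

(** A pair in no edge leaves [l] empty, so all 7 other labels count and the shortage is 0. *)
Definition ishortage (C : seq bitseq) (i j : nat) : nat :=
  let l := [seq m <- C | nth false m i && nth false m j] in
  2 - count (fun k => [&& k != i, k != j & all (fun m => nth false m k) l])
            (iota 0 9).

Definition idel8 (C : seq bitseq) : seq bitseq := [seq m <- C | ~~ nth false m 8].

Definition inonadjs (C : seq bitseq) : nat :=
  let C' := idel8 C in ipairsum 8 (inonadj C').
Definition ifars (C : seq bitseq) : nat :=
  let C' := idel8 C in ipairsum 8 (ifar C').

(* A bound valid for every edge set between C (edges known to be present) and
   U (edges not yet excluded).  Here and in [refute], [if] replaces [&&], whose
   arguments the virtual machine evaluates strictly. *)
Definition feasible (C U : seq bitseq) : bool :=
  if has (fun m => ~~ [|| nth false m 0, nth false m 4 | nth false m 8]) U then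
    let b := ifars C in
    if 4 * (inonadjs U + ifars U) + ipairsum 9 (ishortage C) <= 9 * b + 64 then
      ipairsum 9 (inonadj U) + 16 <= inonadjs C + b
    else false
  else false.

(** Branch and bound: [C] holds the edges decided to be present, [rest] the undecided ones. A branch
    closes when the bound fails; otherwise the next edge is first left out, then put in. *)
Fixpoint refute (rest C : seq bitseq) : bool :=
  if feasible C (C ++ rest) then
    if rest is m :: r then
      if refute r C then refute r (m :: C) else false
    else false
  else true.

Fixpoint masks (n : nat) : seq bitseq :=
  if n is n'.+1 then [seq b :: m | b <- [:: true; false], m <- masks n']
  else [:: [::]].

Definition edge0123 : bitseq := nseq 4 true ++ nseq 5 false.
Definition edge4567 : bitseq := nseq 4 false ++ nseq 4 true ++ [:: false].

Definition quads : seq bitseq := [seq m <- masks 9 | count id m == 4].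

(** An edge through 0 or 4 other than the two given ones must contain 8, which leaves 15 masks
    avoiding 0, 4, 8 and 56 masks through 8. Once all of the first group are left out, the first
    test of [feasible] closes the branch. *)
Definition candidates : seq bitseq :=
  [seq m <- quads | ~~ [|| nth false m 0, nth false m 4 | nth false m 8]] ++
  [seq m <- quads | nth false m 8].

Lemma refutation : refute candidates [:: edge0123; edge4567].
Proof. vm_cast_no_check (erefl true). Qed.

Lemma ipairsumE n f :
  ipairsum n f = \sum_(i <- iota 0 n) \sum_(j <- iota 0 n | j != i) f i j.
Proof.
rewrite /ipairsum sumnE big_map; apply: eq_bigr => i _.
by rewrite sumnE big_map big_filter.
Qed.

Lemma eq_ipairsum n f g :
  (forall i j, i < n -> j < n -> j != i -> f i j = g i j) -> ipairsum n f = ipairsum n g.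
Proof.
move=> fg; rewrite !ipairsumE big_seq [RHS]big_seq; apply: eq_bigr => i.
rewrite mem_iota => /andP[_ i_n]; rewrite big_seq_cond [RHS]big_seq_cond.
apply: eq_bigr => j; rewrite mem_iota => /andP[/andP[_ j_n] ji]; exact: fg.
Qed.

Lemma leq_ipairsum n f g : (forall i j, f i j <= g i j) ->
  ipairsum n f <= ipairsum n g.
Proof.
by move=> fg; rewrite !ipairsumE; apply: leq_sum => i _; apply: leq_sum => j _.
Qed.

(** * Monotonicity in the edge set and soundness of the search *)

Section Monotonicity.
Variables C U : seq bitseq.
Hypothesis CU : {subset C <= U}.

Lemma subset_has (a : pred bitseq) : has a C -> has a U.
Proof. by case/hasP=> m mC am; apply/hasP; exists m => //; apply: CU. Qed.

Lemma sub_iadj i j : iadj C i j -> iadj U i j. Proof. exact: subset_has. Qed.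

Lemma sub_inonadj i j : inonadj U i j <= inonadj C i j.
Proof.
rewrite /inonadj; case C1: (iadj C i j); first by rewrite (sub_iadj C1).
by rewrite leq_b1.
Qed.

Lemma sub_ifar i j : ifar U i j <= ifar C i j.
Proof.
rewrite /ifar; case: (boolP (_ || _ : bool)) => // nU.
suff -> : iadj C i j || has (fun k => iadj C i k && iadj C k j) (iota 0 9) = false by [].
apply: contraNF nU => /orP[/sub_iadj -> //|/hasP[k k9 /andP[ik kj]]].
by apply/orP; right; apply/hasP; exists k; rewrite ?sub_iadj.
Qed.

(** More edges through a pair leave fewer vertices common to all of them. *)
Lemma sub_ishortage i j : ishortage C i j <= ishortage U i j.
Proof.
apply: leq_sub2l; apply: sub_count => k /= /and3P[-> -> /allP all_k] /=.
apply/allP => m; rewrite mem_filter => /andP[mij mC]; apply: all_k.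
by rewrite mem_filter mij CU.
Qed.

Lemma sub_idel8 : {subset idel8 C <= idel8 U}.
Proof. by move=> m; rewrite !mem_filter => /andP[-> /CU]. Qed.

End Monotonicity.

(** Each count in [feasible] is taken at whichever of C and U makes the test weaker, so the tests
    passed by E are passed by the bounds. *)
Lemma feasible_sub C E U : {subset C <= E} -> {subset E <= U} ->
  feasible E E -> feasible C U.
Proof.
move=> CE EU; rewrite /feasible; case: ifP => // /(subset_has EU) ->.
case: ifP => // le1 le2.
have farE : ifars E <= ifars C.
  by apply: leq_ipairsum => i j; apply: sub_ifar; apply: sub_idel8.
have farU : ifars U <= ifars E.
  by apply: leq_ipairsum => i j; apply: sub_ifar; apply: sub_idel8.
have nonE : inonadjs E <= inonadjs C.
  by apply: leq_ipairsum => i j; apply: sub_inonadj; apply: sub_idel8.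
have nonU : inonadjs U <= inonadjs E.
  by apply: leq_ipairsum => i j; apply: sub_inonadj; apply: sub_idel8.
have sC : ipairsum 9 (ishortage C) <= ipairsum 9 (ishortage E).
  by apply: leq_ipairsum => i j; apply: sub_ishortage.
have sU : ipairsum 9 (inonadj U) <= ipairsum 9 (inonadj E).
  by apply: leq_ipairsum => i j; apply: sub_inonadj.
rewrite ifT; last by lia.
by lia.
Qed.

(** A node where the bound fails is settled by [feasible_sub]. At a branching node, E contains m,
    which then joins the lower bound, or misses m, which then leaves the upper bound. *)
Lemma refute_sound E rest C : {subset C <= E} -> {subset E <= C ++ rest} ->
  refute rest C -> ~~ feasible E E.
Proof.
elim: rest C => [|m r IHr] C CE EC /=.
  by case: ifP => // /negbT nf _; apply: contra nf; apply: feasible_sub.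
case: ifP => [_|/negbT nf _]; last by apply: contra nf; apply: feasible_sub.
case: ifP => // refC refmC; case: (boolP (m \in E)) => mE.
  apply: (IHr (m :: C)) => // m'; first by rewrite inE => /predU1P[->|/CE].
  by move/EC; rewrite !(mem_cat, inE) => /or3P[] ->; rewrite ?orbT.
apply: (IHr C) => // m' m'E; have := EC m' m'E; rewrite !(mem_cat, inE).
by case/or3P=> [->||->] //; rewrite ?orbT //; move/eqP=> mm; rewrite -mm m'E in mE.
Qed.

Lemma mem_masks m : m \in masks (size m).
Proof.
elim: m => // b m IHm; have bb : b \in [:: true; false] by case: b.
exact: (allpairs_f cons bb IHm).
Qed.

(** * Transfer of the counts from H to masks *)

Section Labelling.
Variables (T : finType) (H : hypergraph T).

Lemma sum_label (x0 : T) (A : {set T}) (s : seq T) (P : pred T) (g : T -> nat) :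
  uniq s -> s =i A ->
  \sum_(x in A | P x) g x
  = \sum_(i <- iota 0 (size s) | P (nth x0 s i)) g (nth x0 s i).
Proof.
move=> us sA; rewrite -(big_map (nth x0 s) P g) map_nth_iota0 // take_size.
rewrite -big_enum_cond; apply/perm_big/uniq_perm; rewrite ?enum_uniq // => x.
by rewrite mem_enum sA.
Qed.

Lemma pairsum_label (x0 : T) (A : {set T}) (s : seq T) (f : T -> T -> nat) :
  uniq s -> s =i A ->
  pairsum A f = ipairsum (size s) (fun i j => f (nth x0 s i) (nth x0 s j)).
Proof.
move=> us sA; rewrite ipairsumE /pairsum.
under eq_bigl do rewrite -[_ \in A]andbT.
rewrite (sum_label x0 xpredT _ us sA) big_seq [RHS]big_seq.
apply: eq_bigr => i; rewrite mem_iota add0n => /andP[_ i_s].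
rewrite (sum_label x0 _ _ us sA) big_seq_cond [RHS]big_seq_cond.
apply: eq_bigl => j; rewrite mem_iota add0n /=; case: ltnP => //= j_s.
by rewrite nth_uniq.
Qed.

(** The vertex v comes last and so gets label 8; labels 0 to 7 enumerate H \ v. *)
Variables (s : seq T) (v : T).
Hypotheses (us : uniq (rcons s v)) (sV : rcons s v =i hverts H) (s8 : size s = 8).
Notation lab := (nth v (rcons s v)).

Definition mask_of (e : {set T}) : bitseq := [seq z \in e | z <- rcons s v].

Definition mask_edges : seq bitseq := [seq mask_of e | e <- enum (hedges H)].

Lemma size_lab : size (rcons s v) = 9. Proof. by rewrite size_rcons s8. Qed.

Lemma nth_mask e i : i < 9 -> nth false (mask_of e) i = (lab i \in e).
Proof. by move=> i9; rewrite (nth_map v) // size_lab. Qed.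

Lemma mask_ofP m : reflect (exists2 e, e \in hedges H & m = mask_of e) (m \in mask_edges).
Proof.
apply: (iffP mapP) => -[e eH ->]; exists e => //; first by rewrite mem_enum in eH.
by rewrite mem_enum.
Qed.

Lemma mask_of_masks e : mask_of e \in masks 9.
Proof. by rewrite -size_lab -(size_map (mem e)) mem_masks. Qed.

Lemma count_mask e : e \in hedges H -> count id (mask_of e) = #|e|.
Proof.
move=> eH; rewrite /mask_of count_map -size_filter.
rewrite -(card_uniqP (filter_uniq _ us)); apply: eq_card => z.
rewrite mem_filter /= sV andb_idr //.
exact: (subsetP (forall_inP (hedges_sub H) _ eH)).
Qed.

Lemma lab8 : lab 8 = v. Proof. by rewrite nth_rcons s8. Qed.

Lemma iadj_mask i j : i < 9 -> j < 9 -> iadj mask_edges i j = hadj H (lab i) (lab j).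
Proof.
move=> i9 j9; apply/hasP/hadjP.
  by case=> m /mask_ofP[e eH ->]; rewrite !nth_mask // => /andP[]; exists e.
case=> e [eH ie je]; exists (mask_of e); first by apply/mask_ofP; exists e.
by rewrite !nth_mask // ie.
Qed.

Lemma iadj_mask8 i j : i < 9 -> j < 9 ->
  iadj (idel8 mask_edges) i j = hadj (hdel H v) (lab i) (lab j).
Proof.
move=> i9 j9; apply/hasP/hadj_hdelP.
  case=> m; rewrite mem_filter => /andP[m8 /mask_ofP[e eH mE]]; move: m8.
  by rewrite mE !nth_mask // lab8 => ve /andP[]; exists e.
case=> e [eH ve ie je]; exists (mask_of e); last by rewrite !nth_mask // ie.
by rewrite mem_filter nth_mask // lab8 ve; apply/mask_ofP; exists e.
Qed.

Lemma label8 i : i < 8 -> nth v s i = lab i.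
Proof. by move=> i8; rewrite nth_rcons s8 i8. Qed.

Lemma mem_s : s =i hverts (hdel H v).
Proof.
move=> z; rewrite !inE -sV mem_rcons inE; case: eqVneq => //= ->.
by move: us; rewrite rcons_uniq => /andP[/negPf].
Qed.

Lemma uniq_s : uniq s. Proof. by move: us; rewrite rcons_uniq => /andP[]. Qed.

Lemma nonadj_mask : ipairsum 9 (inonadj mask_edges) = pairsum (hverts H) (nonadj H).
Proof.
rewrite (pairsum_label v _ us sV) size_lab; apply: eq_ipairsum => i j i9 j9 _.
by rewrite /inonadj iadj_mask.
Qed.

Lemma nonadjs_mask : inonadjs mask_edges = nonadjs H v.
Proof.
rewrite /nonadjs (pairsum_label v _ uniq_s mem_s) s8; apply: eq_ipairsum => i j i8 j8 _.
by rewrite /inonadj iadj_mask8 1?ltnW // !label8.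
Qed.

Lemma fars_mask : ifars mask_edges = fars H v.
Proof.
rewrite /fars (pairsum_label v _ uniq_s mem_s) s8; apply: eq_ipairsum => i j i8 j8 _.
have [i9 j9] : i < 9 /\ j < 9 by split; apply: ltnW.
rewrite /ifar /far iadj_mask8 // !label8 //; congr (nat_of_bool (~~ (_ || _))).
apply/hasP/existsP => [[k]|[z /andP[iz zj]]].
  by rewrite mem_iota => /andP[_ k9]; rewrite !iadj_mask8 //; exists (lab k).
(* A common neighbour lies in an edge, hence is a vertex and has a label. *)
have zs : z \in rcons s v.
  by have := hadj_vert iz; rewrite -mem_s mem_rcons inE orbC => ->.
exists (index z (rcons s v)); first by rewrite mem_iota /= add0n -size_lab index_mem.
by rewrite !iadj_mask8 ?nth_index ?iz // -size_lab index_mem.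
Qed.

Lemma shortage_mask : ipairsum 9 (ishortage mask_edges) = pairsum (hverts H) (shortage H).
Proof.
rewrite (pairsum_label v _ us sV) size_lab; apply: eq_ipairsum => i j i9 j9 _.
rewrite /ishortage /shortage ownE; congr (2 - _).
rewrite -sum1_count -sum1dep_card.
rewrite (sum_label v _ _ us sV) size_lab big_seq_cond [RHS]big_seq_cond.
apply: eq_bigl => k; rewrite mem_iota /= add0n; case: ltnP => //= k9.
rewrite !nth_uniq ?size_lab //; congr [&& _, _ & _].
(* Label k lies in all masks through i and j exactly when no edge through the pair avoids
   [lab k]. *)
apply/allP/idP => [all_k|nk m].
  apply/hadj_hdelP => -[e [eH ke ie je]].
  have me : mask_of e \in mask_edges by apply/mask_ofP; exists e.
  have := all_k (mask_of e); rewrite mem_filter !nth_mask // ie je me /= (negPf ke).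
  by move/(_ isT).
rewrite mem_filter => /andP[mij /mask_ofP[e eH mE]]; move: mij; rewrite mE !nth_mask //.
case/andP=> ie je; apply: contraNT nk => ke.
by apply/hadj_hdelP; exists e.
Qed.

End Labelling.

Lemma map_mem_nseq (T : finType) (A : {set T}) b (s : seq T) :
  {in s, forall z, (z \in A) = b} -> [seq z \in A | z <- s] = nseq (size s) b.
Proof.
elim: s => //= a s IHs sb; rewrite sb ?mem_head // IHs // => z zs.
by rewrite sb // inE zs orbT.
Qed.

(** * Labelling by the two far vertices, and conclusion *)

Theorem mainTheorem7 (T : finType) (H : hypergraph T)
  (order9 : horder H = 9) (uniform4 : uniform H 4) : ~ soltes H.
Proof.
move=> sol.
have [v [x [y [vV le1 le2 [xV yV yx fxy]]]]] := soltes_far order9 uniform4 sol.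
have xy : x != y by rewrite eq_sym.
have [A [B [[AH BH xA yB dAB] [uA uB [f fH /andP[xf yf]]]]]] :=
  far_edges (horder_hdel order9 vV) (uniform_hdel uniform4 (v := v))
    (soltes_hdel_connected sol vV) xV yV xy fxy.
have VAB : A :|: B = hverts H :\ v.
  exact: (disjoint_edges_cover (horder_hdel order9 vV) (uniform_hdel uniform4 (v := v))).
have card3 (e : {set T}) z : e \in hedges (hdel H v) -> z \in e -> size (enum (e :\ z)) = 3.
  move=> eH ze; have := uniform_hdel uniform4 eH.
  by rewrite (cardsD1 z) ze -cardE => -[].
(* A takes labels 0 to 3 with x first, B takes 4 to 7 with y first. *)
pose sA := x :: enum (A :\ x); pose sB := y :: enum (B :\ y); pose s := sA ++ sB.
have memD (e : {set T}) z : z \in e -> z :: enum (e :\ z) =i e.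
  by move=> ze a; rewrite !inE mem_enum !inE; case: eqVneq => // ->.
have usD (e : {set T}) z : uniq (z :: enum (e :\ z)).
  by rewrite /= enum_uniq mem_enum !inE eqxx.
have sE : s =i hverts H :\ v.
  by move=> z; rewrite mem_cat !memD // -VAB inE.
have us : uniq (rcons s v).
  rewrite rcons_uniq sE !inE eqxx cat_uniq !usD andbT andTb.
  apply/hasPn => z; rewrite memD // => zB; rewrite memD //.
  by rewrite (disjointFl dAB zB).
have sV : rcons s v =i hverts H.
  by move=> z; rewrite mem_rcons inE sE !inE; case: eqVneq => // ->.
have s8 : size s = 8 by rewrite size_cat /= !card3.
have vA : v \notin A by move: AH; rewrite inE => /andP[].
have vB : v \notin B by move: BH; rewrite inE => /andP[].
have maskA : mask_of s v A = edge0123.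
  rewrite /mask_of map_rcons map_cat (negPf vA).
  rewrite (@map_mem_nseq _ A true sA) ?(@map_mem_nseq _ A false sB) /= ?card3 //.
    by move=> z; rewrite memD // => zB; rewrite (disjointFl dAB zB).
  by move=> z; rewrite memD.
have maskB : mask_of s v B = edge4567.
  rewrite /mask_of map_rcons map_cat (negPf vB).
  rewrite (@map_mem_nseq _ B false sA) ?(@map_mem_nseq _ B true sB) /= ?card3 //.
    by move=> z; rewrite memD.
  by move=> z; rewrite memD // => zA; rewrite (disjointFr dAB zA).
have lab0 : nth v (rcons s v) 0 = x by [].
have lab4 : nth v (rcons s v) 4 = y.
  by rewrite nth_rcons s8 /= nth_cat card3.
have labv : nth v (rcons s v) 8 = v by apply: lab8.
have hdelE e : e \in hedges H -> v \notin e -> e \in hedges (hdel H v).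
  by move=> eH ve; rewrite inE eH.
have inH e : e \in hedges (hdel H v) -> e \in hedges H by rewrite inE => /andP[].
set E := mask_edges H s v.
have CE : {subset [:: edge0123; edge4567] <= E}.
  by move=> m; rewrite !inE => /orP[] /eqP->; apply/mask_ofP;
    [exists A|exists B]; rewrite ?inH.
(* An edge avoiding v is A if it contains x and B if it contains y; every other edge is a
   candidate. *)
have EU : {subset E <= [:: edge0123; edge4567] ++ candidates}.
  move=> m /mask_ofP[e eH ->].
  have m4 : count id (mask_of s v e) == 4 by rewrite (count_mask us sV) ?uniform4.
  have m9 : mask_of s v e \in masks 9 by apply: mask_of_masks.
  rewrite mem_cat mem_seq2 /candidates mem_cat !mem_filter m4 m9.
  rewrite !(nth_mask v s8) // lab0 lab4 labv.
  have [ve|ve] := boolP (v \in e); first by rewrite !orbT.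
  have [xe|xe] := boolP (x \in e); first by rewrite (uA e) ?hdelE // maskA eqxx.
  have [ye|ye] := boolP (y \in e); last by rewrite !orbT.
  by rewrite (uB e) ?hdelE // maskB eqxx orbT.
have := refute_sound CE EU refutation; rewrite /feasible.
(* The first test of [feasible] is met by f, which avoids x, y and v, the labels 0, 4 and 8. *)
rewrite ifT; last first.
  apply/hasP; exists (mask_of s v f); first by apply/mask_ofP; exists f; rewrite ?inH.
  rewrite !(nth_mask v s8) // lab0 lab4 labv (negPf xf) (negPf yf).
  by move: fH; rewrite inE => /andP[].
rewrite (nonadjs_mask us sV s8) (fars_mask us sV s8).
rewrite (shortage_mask us sV s8) (nonadj_mask us sV s8).
by rewrite le1 le2.
Qed.
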